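(* Let $s\in\mathbb{N}^+$, let $r\le d\le n$ be positive integers, and let $\epsilon,\delta\in(0,1)$. Suppose that $m\in\mathbb{N}^+$ is chosen such that, for some $\mu>0$, the distribution of 1-hashing matrices $S\in\mathbb{R}^{m\times ns}$ is an $(\epsilon,\delta)$-oblivious subspace embedding for any matrix $B\in\mathbb{R}^{ns\times d}$ with rank $r$ and $\mu(B)\le\mu$. Then the distribution of $s$-hashing variant matrices $T\in\mathbb{R}^{m\times n}$ is an $(\epsilon,\delta)$-oblivious subspace embedding for any matrix $A\in\mathbb{R}^{n\times d}$ with rank $r$ and $\mu(A)\le\mu\sqrt{s}$.
   Context: Coherence: if $A=U\Sigma V^T$ is the compact SVD of a rank-$r$ matrix $A$ ($U$ having $r$ orthonormal columns), then $\mu(A)=\max_i\|U_i\|_2$, where $U_i$ is the $i$-th row of $U$. 1-hashing matrix: a random matrix such that, independently for each column $j$, a row index $i$ is sampled uniformly at random and the $(i,j)$ entry is $\pm1$ with equal probability; all other entries are zero. $s$-hashing variant matrix: a random matrix $T\in\mathbb{R}^{m\times n}$ such that, independently for each column $j\in\{1,\dots,n\}$, indices $i_1,\dots,i_s\in\{1,\dots,m\}$ are sampled uniformly at random with replacement and, starting from zero, $\pm1/\sqrt{s}$ (independent signs, equal probability) is added to $T_{i_kj}$ for each $k=1,\dots,s$. A matrix $S$ is an $\epsilon$-subspace embedding for $A$ if $(1-\epsilon)\|Ax\|_2^2\le\|SAx\|_2^2\le(1+\epsilon)\|Ax\|_2^2$ for all $x$. A distribution of random matrices is an $(\epsilon,\delta)$-oblivious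 subspace embedding for any matrix in a given class if, for each fixed matrix in the class, a matrix randomly drawn from the distribution is an $\epsilon$-subspace embedding for it with probability at least $1-\delta$. *)

(* Defs.v *)
(* MathComp-Analysis *)
From HB Require Import structures.
From mathcomp Require Import all_boot all_order all_algebra.
From mathcomp Require Import all_classical all_reals all_analysis.
Set Implicit Arguments.
Unset Strict Implicit.
Unset Printing Implicit Defensive.
Import Order.TTheory GRing.Theory Num.Theory.
Local Open Scope classical_set_scope.
Local Open Scope ring_scope.

(* The library norm on matrices is the sup norm, hence an explicit l2 norm. *)
Definition l2norm (R : realType) (m n : nat) (x : 'M[R]_(m, n)) : R :=
  Num.sqrt (\sum_i \sum_j x i j ^+ 2).

Definition compact_svd (R : realType) (n d r : nat) (A : 'M[R]_(n, d))
    (U : 'M[R]_(n, r)) (sigma : 'rV[R]_r) (V : 'M[R]_(d, r)) : Prop :=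
  [/\ A = U *m diag_mx sigma *m V^T,
      U^T *m U = 1%:M,
      V^T *m V = 1%:M &
      forall k, 0 < sigma 0 k].

Definition max_row_norm (R : realType) (n r : nat) (U : 'M[R]_(n, r)) : R :=
  \big[Num.max/0]_(i < n) l2norm (row i U).

(* The common value of [max_row_norm U] over all compact SVDs of [A];
   see [coherenceE] for the independence of the choice of the SVD. *)
Definition coherence (R : realType) (n d : nat) (A : 'M[R]_(n, d)) : R :=
  xget 0 [set c | exists (U : 'M[R]_(n, \rank A)) (sigma : 'rV[R]_(\rank A))
                         (V : 'M[R]_(d, \rank A)),
                    compact_svd A U sigma V /\ c = max_row_norm U].

Section coherence_unique.
Variables (R : realType) (n d r : nat) (A : 'M[R]_(n, d)).

Lemma compact_svd_proj (U U' : 'M[R]_(n, r)) sigma sigma' (V V' : 'M[R]_(d, r)) :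
  compact_svd A U sigma V -> compact_svd A U' sigma' V' ->
  (U' *m U'^T) *m U = U.
Proof.
move=> [AE UU VV s0] [AE' UU' _ _].
pose si : 'rV[R]_r := \row_k (sigma 0 k)^-1.
have ssi : diag_mx sigma *m diag_mx si = 1%:M.
  rewrite mulmx_diag -diag_const_mx; congr diag_mx.
  by apply/rowP => k; rewrite !mxE divff// gt_eqF.
have UE : U = A *m V *m diag_mx si.
  by rewrite AE -!mulmxA (mulmxA V^T) VV mul1mx ssi mulmx1.
have {UE} -> : U = U' *m (diag_mx sigma' *m V'^T *m V *m diag_mx si).
  by rewrite UE AE' !mulmxA.
by rewrite -mulmxA (mulmxA U'^T) UU' mul1mx.
Qed.

Lemma compact_svd_max_row_norm (U U' : 'M[R]_(n, r)) sigma sigma'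
    (V V' : 'M[R]_(d, r)) :
  compact_svd A U sigma V -> compact_svd A U' sigma' V' ->
  max_row_norm U = max_row_norm U'.
Proof.
move=> h h'.
have e : U *m U^T = U' *m U'^T.
  have e1 := compact_svd_proj h h'; have e2 := compact_svd_proj h' h.
  rewrite -{1}e1 -mulmxA; apply: trmx_inj.
  by rewrite !trmx_mul !trmxK mulmxA e2.
apply: eq_bigr => i _; congr Num.sqrt; rewrite !big_ord1.
have /matrixP/(_ i i) := e; rewrite !mxE.
under eq_bigr do rewrite mxE -expr2.
under [X in _ = X -> _]eq_bigr do rewrite mxE -expr2.
move=> e'; under eq_bigr do rewrite mxE.
by under [RHS]eq_bigr do rewrite mxE.
Qed.

End coherence_unique.

Lemma coherenceE (R : realType) (n d : nat) (A : 'M[R]_(n, d))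
    (U : 'M[R]_(n, \rank A)) (sigma : 'rV[R]_(\rank A))
    (V : 'M[R]_(d, \rank A)) :
  compact_svd A U sigma V -> coherence A = max_row_norm U.
Proof.
move=> h; rewrite /coherence;
case: xgetP => [c _ [U' [s' [V' [h' ->]]]]|/(_ (max_row_norm U))].
  exact: compact_svd_max_row_norm h' h.
by case; exists U, sigma, V.
Qed.

Definition uniform_rv (R : realType) (disp : measure_display)
    (Omega : measurableType disp) (P : probability Omega R) (V : finType)
    (X : Omega -> V) : Prop :=
  (forall A : set V, measurable (X @^-1` A)) /\
  (forall v : V, P (X @^-1` [set v]) = (#|V|%:R^-1)%:E).

Definition independent_rvs (R : realType) (disp : measure_display)
    (Omega : measurableType disp) (P : probability Omega R) (I V : finType)
    (X : I -> Omega -> V) : Prop :=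
  forall (J : {set I}) (A : I -> set V),
    (P (\bigcap_(i in [set` J]) (X i @^-1` A i)) =
       \prod_(i in J) P (X i @^-1` A i))%E.

(* A draw [(i, b)], uniform on ['I_m * bool], is a uniform row index [i]
   together with an independent fair sign [(-1) ^+ b]. *)
Definition hashing1 (R : realType) (disp : measure_display)
    (Omega : measurableType disp) (P : probability Omega R) (m n : nat)
    (S : Omega -> 'M[R]_(m, n)) : Prop :=
  exists X : 'I_n -> Omega -> 'I_m * bool,
    [/\ forall j, uniform_rv P (X j),
        independent_rvs P X &
        forall w, S w = \matrix_(i < m, j < n)
          (if (X j w).1 == i then (-1) ^+ (X j w).2 else 0)].

(* Draws are indexed by (column, repetition). *)
Definition hashing_variant (R : realType) (disp : measure_display)
    (Omega : measurableType disp) (P : probability Omega R) (s m n : nat)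
    (T : Omega -> 'M[R]_(m, n)) : Prop :=
  exists X : 'I_n * 'I_s -> Omega -> 'I_m * bool,
    [/\ forall jk, uniform_rv P (X jk),
        independent_rvs P X &
        forall w, T w = \matrix_(i < m, j < n) \sum_(k < s)
          (if (X (j, k) w).1 == i
           then (-1) ^+ (X (j, k) w).2 / Num.sqrt s%:R else 0)].

Definition subspace_embedding (R : realType) (m n d : nat) (eps : R)
    (S : 'M[R]_(m, n)) (A : 'M[R]_(n, d)) : Prop :=
  forall x : 'cV[R]_d,
    (1 - eps) * l2norm (A *m x) ^+ 2 <= l2norm (S *m A *m x) ^+ 2
      <= (1 + eps) * l2norm (A *m x) ^+ 2.

(* This only depends on the distribution of the random matrix [S]. *)
Definition oblivious_subspace_embedding (R : realType) (disp : measure_display)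
    (Omega : measurableType disp) (P : probability Omega R) (m n d : nat)
    (eps delta : R) (S : Omega -> 'M[R]_(m, n))
    (class : 'M[R]_(n, d) -> Prop) : Prop :=
  forall A, class A ->
    ((1 - delta)%:E <= P [set w | subspace_embedding eps (S w) A])%E.

Definition rank_coherence_class (R : realType) (n d r : nat) (mu : R)
    (A : 'M[R]_(n, d)) : Prop :=
  \rank A = r /\ coherence A <= mu.

(* Main.v *)
(* Let [W] repeat each coordinate [s] times, scaled by [1 / sqrt s].  It is an
   isometry, so [B = W A] satisfies [|B x| = |A x|], has the rank of [A], and its
   left singular factor is [W U], whose rows are those of [U] divided by [sqrt s].
   On the other hand an [s]-hashing variant matrix is [T = S W] for the 1-hashing
   matrix [S] built from the same draws, so [T A = S B]; and the law of [S] does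
   not depend on the probability space that carries it. *)
Require Import Defs.
From HB Require Import structures.
From mathcomp Require Import all_boot all_order all_algebra.
From mathcomp Require Import all_classical all_reals all_analysis.
Import Order.TTheory GRing.Theory Num.Theory.
Local Open Scope ring_scope.

(** * The Frobenius norm under left isometries *)

Section l2norm_theory.
Context {R : realType}.

Lemma l2norm_ge0 m n (x : 'M[R]_(m, n)) : 0 <= l2norm x.
Proof. exact: sqrtr_ge0. Qed.

Lemma l2norm_tr m n (x : 'M[R]_(m, n)) : l2norm x = Num.sqrt (\tr (x^T *m x)).
Proof.
congr Num.sqrt; rewrite exchange_big; apply: eq_bigr => j _; rewrite mxE.
by apply: eq_bigr => i _; rewrite mxE expr2.
Qed.

Lemma l2norm_isometry m n p (W : 'M[R]_(m, n)) (x : 'M[R]_(n, p)) :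
  W^T *m W = 1%:M -> l2norm (W *m x) = l2norm x.
Proof.
by move=> WW; rewrite !l2norm_tr trmx_mul -mulmxA (mulmxA W^T) WW mul1mx.
Qed.

Lemma l2normZ m n (c : R) (x : 'M[R]_(m, n)) : l2norm (c *: x) = `|c| * l2norm x.
Proof.
rewrite !l2norm_tr -scalemxAr [(c *: x)^T]linearZ -scalemxAl scalerA mxtraceZ -expr2.
by rewrite sqrtrM ?sqr_ge0// sqrtr_sqr.
Qed.

Lemma l2norm_row_le_max n r (U : 'M[R]_(n, r)) i :
  l2norm (row i U) <= max_row_norm U.
Proof. exact: (le_bigmax _ (fun i => l2norm (row i U))). Qed.

End l2norm_theory.

(** * Rank, compact SVD and coherence of [W *m A] against those of [A] *)

Section isometry_svd.
Context {R : realType} {m n d : nat}.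
Variables (W : 'M[R]_(m, n)) (A : 'M[R]_(n, d)).
Hypothesis WW : W^T *m W = 1%:M.

Lemma mxrank_isometry : \rank (W *m A) = \rank A.
Proof.
apply/eqP; rewrite eqn_leq mxrankM_maxr/=.
by have := mxrankM_maxr W^T (W *m A); rewrite mulmxA WW mul1mx.
Qed.

(** The SVD is pulled back from [W *m A] to [A], not pushed forward: bounding the coherence of
    [W *m A] from above only requires examining the SVDs it may have, so no existence result for
    SVDs is called for. *)
Lemma compact_svd_isometry r (U : 'M[R]_(m, r)) sigma (V : 'M[R]_(d, r)) :
  compact_svd (W *m A) U sigma V ->
  compact_svd A (W^T *m U) sigma V /\ U = W *m (W^T *m U).
Proof.
move=> [AE UU VV s0].
pose si : 'rV[R]_r := \row_k (sigma 0 k)^-1.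
have ssi : diag_mx sigma *m diag_mx si = 1%:M.
  rewrite mulmx_diag -diag_const_mx; congr diag_mx.
  by apply/rowP => k; rewrite !mxE divff// gt_eqF.
have UE : U = W *m A *m V *m diag_mx si.
  by rewrite AE -!mulmxA (mulmxA V^T) VV mul1mx ssi mulmx1.
(* By [UE] the columns of [U] lie in the range of [W], which the projection [W *m W^T] fixes. *)
have WU : U = W *m (W^T *m U).
  by rewrite {2}UE !mulmxA -(mulmxA W W^T W) WW mulmx1 -UE.
split=> //; split=> //.
- by rewrite -!mulmxA (mulmxA U) -AE mulmxA WW mul1mx.
- by rewrite trmx_mul trmxK -mulmxA -WU.
Qed.

End isometry_svd.

Lemma coherence_svd (R : realType) (n d r : nat) (A : 'M[R]_(n, d))
    (U : 'M[R]_(n, r)) sigma V :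
  \rank A = r -> compact_svd A U sigma V -> coherence A = max_row_norm U.
Proof. by move=> rA; move: U sigma V; rewrite -rA => U sigma V /coherenceE. Qed.

(* A matrix without compact SVD would have coherence [0] ([xget] default). *)
Lemma coherence_le (R : realType) (n d r : nat) (A : 'M[R]_(n, d)) (c : R) :
  \rank A = r -> 0 <= c ->
  (forall (U : 'M[R]_(n, r)) sigma V, compact_svd A U sigma V ->
     max_row_norm U <= c) ->
  coherence A <= c.
Proof.
move=> rA; rewrite -rA => c0 Uc.
by rewrite /coherence; case: xgetP => // _ _ [U [sigma [V [/Uc + ->]]]].
Qed.

(** * The replication isometry and its effect on coherence *)

Section replication.
Context {R : realType} {n s : nat}.

(** The inverse of [mxvec_index]; it matches the columns of the 1-hashing matrix with the (column,
    repetition) indices of the variant. *)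
Definition unpair_index (p : 'I_(n * s)) : 'I_n * 'I_s :=
  enum_val (cast_ord (esym (mxvec_cast n s)) p).

Lemma mxvec_indexK j k : unpair_index (mxvec_index j k) = (j, k).
Proof. by rewrite /unpair_index /mxvec_index cast_ordK enum_rankK. Qed.

Lemma unpair_index_bij : bijective unpair_index.
Proof.
exists (fun jk => mxvec_index jk.1 jk.2) => [p|[j k]]; last exact: mxvec_indexK.
by case/mxvec_indexP: p => j k; rewrite mxvec_indexK.
Qed.

Lemma sum_mxvec_index (F : 'I_(n * s) -> R) :
  \sum_p F p = \sum_j \sum_k F (mxvec_index j k).
Proof.
rewrite pair_bigA /= (reindex _ (curry_mxvec_bij n s)) /=.
by apply: eq_bigr => -[].
Qed.

Definition replication_mx : 'M[R]_(n * s, n) :=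
  \matrix_(p, j) (((unpair_index p).1 == j)%:R / Num.sqrt s%:R).

(** Distinct columns have disjoint supports, and each column has exactly [s] nonzero entries, of
    square [1 / s]. *)
Lemma replication_mx_isometry :
  (0 < s)%N -> replication_mx^T *m replication_mx = 1%:M.
Proof.
move=> s0; apply/matrixP => i j; rewrite !mxE sum_mxvec_index.
rewrite (bigD1 i)//= [X in _ + X]big1 ?addr0 => [|i' /negPf ii']; last first.
  by apply: big1 => k _; rewrite !mxE mxvec_indexK/= ii' !mul0r.
under eq_bigr do rewrite !mxE mxvec_indexK/= eqxx mul1r mulrCA -invfM -expr2.
rewrite sumr_const card_ord sqr_sqrtr// -[LHS]mulr_natr -mulrA mulVf ?mulr1//.
by rewrite pnatr_eq0 -lt0n.
Qed.

Lemma row_replication_mx r (U : 'M[R]_(n, r)) p :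
  row p (replication_mx *m U) =
  (Num.sqrt s%:R)^-1 *: row (unpair_index p).1 U.
Proof.
apply/rowP => c; rewrite !mxE (bigD1 (unpair_index p).1)//= mxE eqxx mul1r.
by rewrite big1 ?addr0// => j /negPf; rewrite eq_sym mxE => ->; rewrite !mul0r.
Qed.

Lemma coherence_replication_mx d (A : 'M[R]_(n, d)) (mu : R) :
  (0 < s)%N -> 0 <= mu -> coherence A <= mu * Num.sqrt s%:R ->
  coherence (replication_mx *m A) <= mu.
Proof.
move=> s0 mu0 Amu; have WW := replication_mx_isometry s0.
apply: (coherence_le _ _ _ _ _ _ (mxrank_isometry _ _ WW)) => // U sigma V.
move=> /(compact_svd_isometry _ _ WW) [svdA ->].
apply: bigmax_le => // p _; rewrite row_replication_mx l2normZ.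
have s_gt0 : 0 < Num.sqrt (s%:R : R) by rewrite sqrtr_gt0 ltr0n.
rewrite ger0_norm ?invr_ge0 ?(ltW s_gt0)// ler_pdivrMl// mulrC.
apply: le_trans Amu; rewrite (coherence_svd _ _ _ _ _ _ _ _ erefl svdA).
exact: l2norm_row_le_max.
Qed.

End replication.

(** * Factoring the variant through a 1-hashing matrix *)

Lemma subspace_embedding_isometry (R : realType) (m n p d : nat) (eps : R)
    (S : 'M[R]_(m, n)) (W : 'M[R]_(n, p)) (A : 'M[R]_(p, d)) :
  W^T *m W = 1%:M ->
  subspace_embedding eps (S *m W) A <-> subspace_embedding eps S (W *m A).
Proof.
move=> WW; have WA (x : 'cV_d) : l2norm (W *m A *m x) = l2norm (A *m x).
  by rewrite -mulmxA l2norm_isometry.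
by split=> SE x; have := SE x; rewrite !mulmxA WA.
Qed.

Definition hashing_mx (R : realType) (m n : nat) (f : {ffun 'I_n -> 'I_m * bool}) :
    'M[R]_(m, n) :=
  \matrix_(i, j) (if (f j).1 == i then (-1) ^+ (f j).2 else 0).

(** Multiplying by [replication_mx] adds up the [s] hashing columns attached to [j], so repeated row
    indices accumulate just as in sampling with replacement. *)
Lemma hashing_variant_mxE (R : realType) (m n s : nat)
    (x : 'I_n * 'I_s -> 'I_m * bool) :
  \matrix_(i < m, j < n) \sum_(k < s)
    (if (x (j, k)).1 == i then (-1) ^+ (x (j, k)).2 / Num.sqrt s%:R else 0) =
  hashing_mx R m (n * s) [ffun p => x (unpair_index p)] *m replication_mx.
Proof.
apply/matrixP => i j; rewrite !mxE sum_mxvec_index (bigD1 j)//=.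
rewrite [X in _ + X]big1 ?addr0 => [|j' /negPf jj']; last first.
  by apply: big1 => k _; rewrite !mxE mxvec_indexK/= jj' mul0r mulr0.
apply: eq_bigr => k _; rewrite !mxE ffunE mxvec_indexK eqxx mul1r.
by case: ifP => //; rewrite mul0r.
Qed.

Section joint_law.
Local Open Scope classical_set_scope.
Context {R : realType} {I V : finType}.

(** The normalized counting measure on finite functions; no sample space occurs in it, which is what
    lets two spaces be compared. *)
Definition uniform_product_law (E : set {ffun I -> V}) : \bar R :=
  (\sum_(f \in E) \prod_(i : I) ((#|V|%:R : R)^-1)%:E)%E.

(** The event splits into finitely many disjoint cells, one per outcome [f] in [E], and independence
    over the full index set gives each cell its product weight. The bijection [g] absorbs the
    different indexing of the draws. *)
Lemma probability_uniform_independent (disp : measure_display)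
    (Omega : measurableType disp) (P : probability Omega R) (J : finType)
    (X : J -> Omega -> V) (g : I -> J) (E : set {ffun I -> V}) :
  bijective g -> (forall j, uniform_rv P (X j)) -> independent_rvs P X ->
  P [set w | E [ffun i => X (g i) w]] = uniform_product_law E.
Proof.
move=> [h gK hK] Xunif Xind.
pose cell (f : {ffun I -> V}) :=
  \bigcap_(j in [set` [set: J]%SET]) (X j @^-1` [set f (h j)]).
have cellP f w : cell f w <-> [ffun i => X (g i) w] = f.
  split=> [fw|<- j _]; last by rewrite /preimage/= ffunE hK.
  by apply/ffunP => i; rewrite ffunE fw ?gK//= inE.
have -> : [set w | E [ffun i => X (g i) w]] = \bigcup_(f in E) cell f.
  apply/seteqP; split=> [w Ew|w [f Ef /cellP fw]] /=; last by rewrite fw.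
  by exists [ffun i => X (g i) w] => //; apply/cellP.
rewrite measure_fin_bigcup.
- apply: eq_fsbigr => f _; apply: (etrans (Xind _ (fun j => [set f (h j)]))).
  rewrite (reindex g); last by exists h => ? _.
  by apply: eq_big => [i|i _]; rewrite ?inE//; have [_ ->] := Xunif (g i).
- exact: finite_finset.
- by move=> f f' _ _ [w [/cellP <- /cellP <-]].
- move=> f _; apply: fin_bigcap_measurable => [|j _]; first exact: finite_finset.
  by have [+ _] := Xunif j; apply.
Qed.

End joint_law.

Theorem theorem2p4p2 (R : realType) (s r d n m : nat) (eps delta mu : R)
    (dispS : measure_display) (OmegaS : measurableType dispS)
    (PS : probability OmegaS R) (S : OmegaS -> 'M[R]_(m, n * s))
    (dispT : measure_display) (OmegaT : measurableType dispT)
    (PT : probability OmegaT R) (T : OmegaT -> 'M[R]_(m, n)) :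
  (0 < s)%N -> (0 < r)%N -> (r <= d)%N -> (d <= n)%N -> (0 < m)%N ->
  0 < eps < 1 -> 0 < delta < 1 -> 0 < mu ->
  hashing1 PS S ->
  oblivious_subspace_embedding PS eps delta S
    (@rank_coherence_class R (n * s) d r mu) ->
  hashing_variant PT s T ->
  oblivious_subspace_embedding PT eps delta T
    (@rank_coherence_class R n d r (mu * Num.sqrt s%:R)).
Proof.
move=> s0 _ _ _ _ _ _ mu0 [X [Xunif Xind SE]] Sose [Y [Yunif Yind TE]] A [rA Amu].
have WW := @replication_mx_isometry R n s s0.
pose E : set {ffun 'I_(n * s) -> 'I_m * bool} :=
  [set f | subspace_embedding eps (hashing_mx R m _ f) (replication_mx *m A)]%classic.
have := Sose (replication_mx *m A).
(* The explicit [id] gives this event the same shape as the one for [T], with reindexing bijection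
   [id]. *)
have -> : [set w | subspace_embedding eps (S w) (replication_mx *m A)]%classic =
    [set w | E [ffun p => X (id p) w]]%classic.
  apply: eq_set => w; rewrite /E/= SE; congr (subspace_embedding _ _ _).
  by apply/matrixP => i j; rewrite !mxE ffunE.
have -> : [set w | subspace_embedding eps (T w) A]%classic =
    [set w | E [ffun p => Y (unpair_index p) w]]%classic.
  apply: eq_set => w; rewrite TE (hashing_variant_mxE _ _ _ _ (fun jk => Y jk w)).
  exact/propext/subspace_embedding_isometry.
(* Both probabilities become [uniform_product_law E]; it remains to check that [replication_mx *m A]
   belongs to the class assumed for [S]. *)
rewrite !probability_uniform_independent//; last 2 first.
- exact: unpair_index_bij.
- by exists id.
apply; split; first by rewrite mxrank_isometry.
by apply: coherence_replication_mx => //; exact: ltW.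
Qed.
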